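(* Let $P_4$ be the path on four nodes and let $T$ be an arbitrary threshold graph on $m$ nodes. Then the number of nonempty faces of the Hansen polytope of $P_4\ltimes T$ is $$\mathrm{s}(\mathrm{H}(P_4\ltimes T)) = 3^{m+5}+16.$$
   Context: All graphs are finite and simple. A graph $G$ is a split graph if its node set can be partitioned into a clique $C$ and a stable set $S$; we write $G=C\cup S$. The path $P_4$ is a split graph with $C$ consisting of its two middle nodes and $S$ consisting of its two endpoints. A node of a graph is dominating if it is adjacent to all other nodes, and isolated if it is adjacent to no other node. A graph is a threshold graph if it can be constructed from the empty graph (no nodes) by repeatedly adding either an isolated node or a dominating node (isolated, resp. dominating, in the graph at the moment of its addition). For a split graph $G=C\cup S$ and a threshold graph $T$, the graph $G\ltimes T$ is obtained from the disjoint union of $G$ and $T$ by adding all edges between nodes of $C$ and nodes of $T$. For a graph $G=(V,E)$, the stable set polytope is $\mathrm{stab}(G)=\mathrm{conv}\{\sum_{i\in I}e_i : I\subseteq V \text{ stable}\}\subseteq\mathbb{R}^{V}$ (the empty set is stable). The twisted prism of a polytope $P\subseteq\mathbb{R}^n$ is $\mathrm{tp}(P)=\mathrm{conv}(Q\cup -Q)\subseteq\mathbb{R}^{n+1}$ with $Q=\{1\}\times P$. The Hansen polytope of $G$ is $\mathrm{H}(G)=\mathrm{tp}(\mathrm{stab}(G))$. For a polytope $P$, $\mathrm{s}(P)$ is the number of nonempty faces of $P$, with $P$ itself counted as a face. *)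

(* Defs.v *)
From HB Require Import structures.
From mathcomp Require Import all_boot all_order all_algebra.

Set Implicit Arguments.
Unset Strict Implicit.
Unset Printing Implicit Defensive.

Import GRing.Theory.

Record sgraph := SGraph {
  node :> finType;
  edge : rel node;
  edge_sym : symmetric edge;
  edge_irr : irreflexive edge }.

Definition stable (G : sgraph) (I : {set G}) : Prop :=
  {in I &, forall x y, ~~ edge x y}.

Definition clique (G : sgraph) (K : {set G}) : Prop :=
  {in K &, forall x y, x != y -> edge x y}.

Definition sgraph_iso (G H : sgraph) : Prop :=
  exists2 f : G -> H, bijective f & {mono f : x y / edge x y}.

Section AddNode.
Variables (G : sgraph) (b : bool).

Definition add_node_edge (x y : option G) : bool :=
  match x, y with
  | Some u, Some v => edge u v
  | None, None => false
  | _, _ => b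
  end.

Lemma add_node_sym : symmetric add_node_edge.
Proof. by case=> [x|] [y|] //=; exact: edge_sym. Qed.

Lemma add_node_irr : irreflexive add_node_edge.
Proof. by case=> [x|] //=; exact: edge_irr. Qed.

(* The new node [None] is dominating if b = true, isolated if b = false. *)
Definition add_node : sgraph := SGraph add_node_sym add_node_irr.

End AddNode.

Definition add_isolated (G : sgraph) : sgraph := add_node G false.
Definition add_dominating (G : sgraph) : sgraph := add_node G true.

(* Closure under isomorphism is needed because adding a node changes the
   node type from G to option G. *)
Inductive threshold : sgraph -> Prop :=
| threshold_empty (G : sgraph) : #|G| = 0 -> threshold G
| threshold_isolated (G : sgraph) : threshold G -> threshold (add_isolated G)
| threshold_dominating (G : sgraph) :
    threshold G -> threshold (add_dominating G)
| threshold_iso (G H : sgraph) : sgraph_iso G H -> threshold G -> threshold H.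

(* A graph together with a chosen partition of its nodes into a clique and a
   stable set; either part may be empty. *)
Record split_graph := SplitGraph {
  split_sgraph :> sgraph;
  clique_part : {set split_sgraph};
  stable_part : {set split_sgraph};
  clique_partP : clique clique_part;
  stable_partP : stable stable_part;
  split_cover : clique_part :|: stable_part = [set: split_sgraph];
  split_disjoint : [disjoint clique_part & stable_part] }.

Section Ltimes.
Variables (G : split_graph) (T : sgraph).

Definition ltimes_edge (x y : G + T) : bool :=
  match x, y with
  | inl u, inl v => edge u v
  | inr s, inr t => edge s t
  | inl u, inr _ => u \in clique_part G
  | inr _, inl u => u \in clique_part G
  end.

Lemma ltimes_sym : symmetric ltimes_edge.
Proof. by case=> [x|x] [y|y] //=; exact: edge_sym. Qed.

Lemma ltimes_irr : irreflexive ltimes_edge.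
Proof. by case=> [x|x] /=; exact: edge_irr. Qed.

Definition ltimes : sgraph := SGraph ltimes_sym ltimes_irr.

End Ltimes.

Definition P4_edge (i j : 'I_4) : bool :=
  (i.+1 == j :> nat) || (j.+1 == i :> nat).

Lemma P4_sym : symmetric P4_edge.
Proof. by move=> i j; rewrite /P4_edge orbC. Qed.

Lemma P4_irr : irreflexive P4_edge.
Proof. by move=> i; rewrite /P4_edge orbb gtn_eqF. Qed.

Definition P4_graph : sgraph := SGraph P4_sym P4_irr.

Definition P4_middle : {set P4_graph} :=
  [set i : 'I_4 | (i == 1 :> nat) || (i == 2 :> nat)].

Definition P4_ends : {set P4_graph} :=
  [set i : 'I_4 | (i == 0 :> nat) || (i == 3 :> nat)].

Lemma P4_middleP : clique P4_middle.
Proof.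
by move=> [[|[|[|[|i]]]] ?] [[|[|[|[|j]]]] ?]; rewrite !inE.
Qed.

Lemma P4_endsP : stable P4_ends.
Proof.
by move=> [[|[|[|[|i]]]] ?] [[|[|[|[|j]]]] ?]; rewrite !inE.
Qed.

Lemma P4_cover : P4_middle :|: P4_ends = [set: P4_graph].
Proof. by apply/setP => -[[|[|[|[|i]]]] ?]; rewrite !inE. Qed.

Lemma P4_disjoint : [disjoint P4_middle & P4_ends].
Proof.
rewrite -setI_eq0; apply/eqP/setP => -[[|[|[|[|i]]]] ?]; by rewrite !inE.
Qed.

Definition P4 : split_graph :=
  SplitGraph P4_middleP P4_endsP P4_cover P4_disjoint.

From mathcomp Require Import mathcomp_extra boolp classical_sets functions.
From mathcomp Require Import cardinality reals convex.

Local Open Scope ring_scope.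
Local Open Scope classical_set_scope.

Section Polytopes.
Variable R : realType.

Definition conv_hull (E : lmodType R) (A : set E) : set E :=
  smallest (@convex_set R E) A.

Definition incidence (G : sgraph) (I : {set G}) : {ffun G -> R^o} :=
  [ffun i => (i \in I)%:R].

Definition stab (G : sgraph) : set {ffun G -> R^o} :=
  conv_hull [set incidence I | I in [set I : {set G} | stable I]].

Arguments stab : clear implicits.

(* R x E plays the role of R^{n+1}. *)
Definition tp (E : lmodType R) (P : set E) : set (R^o * E)%type :=
  let Q := [set 1] `*` P in conv_hull (Q `|` -%R @` Q).

Definition hansen (G : sgraph) : set (R^o * {ffun G -> R^o})%type :=
  tp (stab G).

Arguments hansen : clear implicits.

(* Intersection of P with the hyperplane of a valid inequality c x <= d; this
   includes P itself and the empty set. *)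
Definition face (E : lmodType R) (P F : set E) : Prop :=
  exists (c : {scalar E}) (d : R),
    (forall x, P x -> c x <= d) /\ F = P `&` [set x | c x = d].

Definition nonempty_faces (E : lmodType R) (P : set E) : set (set E) :=
  [set F | face P F /\ F !=set0].

End Polytopes.

Arguments stab : clear implicits.
Arguments hansen : clear implicits.

(* Main.v *)
Require Import Defs.
From HB Require Import structures.
From mathcomp Require Import all_boot all_order all_algebra.
From mathcomp Require Import boolp classical_sets cardinality reals.
From mathcomp Require Import convex interval_inference ring lra.

(** Let G be a split graph on n nodes with clique C and stable set S. The
    proof counts the faces of the Hansen polytope of every such G, and then
    evaluates the count for P4 extended by a threshold graph.

    A nonempty face is determined by the vertices at which a supporting linear
    functional f attains its maximum M. The vertices are the points (1, I) on
    the upper side and -(1, I) on the lower side, for I stable. A stable set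
    has at most one node in C, its head, so on each side it is a head k, or no
    head, together with any set of nodes of S that are not adjacent to k.
    Relative to f, each side of each head has a gap, the distance to M of the
    best vertex of that side and head. The vertices with this head attain M
    exactly if the gap is zero and the nodes of S available to the head are
    taken or omitted as the signs of the coefficients of f prescribe. Thus a
    face is described by two booleans, telling for which sides the gap without
    a head is zero, and a signing of the nodes in {+, -, 0}: the sign of the
    coefficient on S, and on C the side on which alone the gap is zero.

    For fixed booleans, not every signing occurs as a canonical description.
    - If exactly one of the gaps without a head is zero, all 3^n signings occur
      and they give different faces.
    - If both are zero, the two gaps of k in C add up to the sum of the
      absolute values of the coefficients at the neighbours of k in S. If these
      vanish, k attains M on both sides and has sign 0; so the signings that
      occur are the dominated ones, where each nonzero k in C has a nonzero
      neighbour in S.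
    - If neither is zero, only vertices with a head attain M, so there is a
      nonzero k in C, and the sign of s in S matters only if s is available to
      some nonzero head. Signing all other s with 0, the canonical signings are
      the codominated ones, where some k in C is nonzero and each nonzero s in
      S has a nonzero nonneighbour in C.

    Every signing is dominated or codominated: failing both would yield some k
    in C and s in S that are neither adjacent nor nonadjacent. By
    inclusion-exclusion the number of faces is 3^(n+1) plus the number of
    signings that are both, called the excess of G ([card_faces_hansen]).

    A threshold graph is split, and neighbourhoods of its clique nodes in its
    stable part form a chain. Hence in an extension of G by a threshold graph T
    a signing counted in the excess vanishes on T: a nonzero clique node of T
    would have a nonzero neighbour in T that is adjacent to all nonzero clique
    nodes, against codomination; and without such a clique node, a nonzero
    stable node of T would have no nonzero nonneighbour. So the extension does
    not change the excess ([card_excess_ltimes]). For P4, with path 0 - 1 - 2 - 3, one nonzero middle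
    node forces all four nodes to be nonzero, along the cycle of implications
    1, 0, 2, 3, 1. The excess is therefore 2^4 = 16. *)

Set Implicit Arguments.
Unset Strict Implicit.
Unset Printing Implicit Defensive.

Import Order.TTheory GRing.Theory Num.Theory.

(** * Codes of faces *)

Section SplitGraph.
Variable G : split_graph.
Notation C := (clique_part G).
Notation S := (stable_part G).

Lemma in_stable_part x : (x \in S) = (x \notin C).
Proof.
have : x \in C :|: S by rewrite split_cover inE.
rewrite inE; case: (boolP (x \in C)) => /= [xC _|_ ->] //.
exact: disjointFr (split_disjoint G) xC.
Qed.

Definition head_in (o : option G) := if o is Some k then k \in C else true.

Definition nonadj (o : option G) (s : G) :=
  if o is Some k then ~~ edge k s else true.

(** Filtering [X] makes every set a legal second argument; by [stable_ofE] all
    stable sets arise in this way. *)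
Definition stable_of (o : option G) (X : {set G}) : {set G} :=
  [set x | if x \in C then o == Some x else nonadj o x && (x \in X)].

Lemma stable_ofP o X : head_in o -> stable (stable_of o X).
Proof.
move=> oC x y; rewrite !inE.
case: ifPn => xC; case: ifPn => yC.
- by move=> /eqP-> /eqP[->]; rewrite edge_irr.
- by move=> /eqP-> /= /andP[].
- by move=> /andP[+ _] /eqP oE; rewrite oE /= edge_sym.
- by move=> _ _; apply: (@stable_partP G); rewrite in_stable_part.
Qed.

Lemma stable_ofE (I : {set G}) :
  stable I -> exists2 o, head_in o & I = stable_of o I.
Proof.
move=> stI; case: (pickP [pred x in C | x \in I]) => [k /andP[/= kC kI]|I0].
  exists (Some k) => //; apply/setP => x; rewrite inE.
  case: ifPn => xC /=; last first.
    by case xI: (x \in I); rewrite ?andbF // stI.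
  apply/idP/eqP => [xI|[<-//]]; congr Some.
  apply/eqP; apply: contraT => nkx.
  by have := stI _ _ kI xI; rewrite (clique_partP kC xC nkx).
exists None => //; apply/setP => x; rewrite inE /=.
by have := I0 x; rewrite /=; case: (x \in C).
Qed.

(** [None] is the sign 0. The booleans name the two sides of the prism: [false]
    is the copy at height 1 and [true] its mirror image, so that [Some false] is
    + and [Some true] is -. *)
Definition signing := {ffun G -> option bool}.
(** The pair of booleans tells on which of the sides [true], [false] the face
    contains a vertex whose stable set avoids the clique. *)
Definition code := (bool * bool * signing)%type.
Implicit Types (e : signing) (a : bool * bool) (c : code).

Definition base a (u : bool) := if u then a.1 else a.2.

(** If both sides have vertices without a head, a clique node with this property
    is a head on both sides. *)
Definition blank e k := [forall s in S, edge k s ==> (e s == None)].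

(** The heads that occur among the vertices of the face on side [u]. *)
Definition anchored c u o :=
  if o is Some k then
    (c.2 k == Some u) || [&& c.1.1, c.1.2 & blank c.2 k]
  else base c.1 u.

(** Coefficients change sign between the sides, so a node of sign + is taken on
    the upper side and omitted on the lower one. *)
Definition agree (t : option bool) u (b : bool) :=
  if t is Some d then b == (d == u) else true.

Definition tight c u o (X : {set G}) :=
  anchored c u o && [forall s in S, nonadj o s ==> agree (c.2 s) u (s \in X)].

Definition dominated e :=
  [forall k in C, (e k != None) ==> [exists s in S, edge k s && (e s != None)]].

Definition codominated e :=
  [exists k in C, e k != None] &&
  [forall s in S, (e s != None) ==>
    [exists k in C, ~~ edge k s && (e k != None)]].

(** One code for each face: the conditions discard the signings that cannot occur
    or that carry signs which no vertex of the face sees. *)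
Definition good c :=
  if c.1.1 && c.1.2 then dominated c.2
  else if c.1.1 || c.1.2 then true else codominated c.2.

(** The least and the greatest vertex set that a head allows are used as probes:
    together they reveal the signs of all available nodes. *)
Lemma tight_least c u o :
  tight c u o [set s | c.2 s == Some u] = anchored c u o.
Proof.
rewrite /tight andb_idr // => _; apply/forall_inP => s _; apply/implyP => _.
by rewrite inE; case: (c.2 s) => [d|] //=; rewrite eqxx.
Qed.

Lemma tight_most c u o :
  tight c u o [set s | c.2 s != Some (~~ u)] = anchored c u o.
Proof.
rewrite /tight andb_idr // => _; apply/forall_inP => s _; apply/implyP => _.
by rewrite inE; case: (c.2 s) => [[]|] //=; case: u.
Qed.

Lemma tight_sub_anchored c u o X : tight c u o X -> anchored c u o.
Proof. by case/andP. Qed.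

Definition same_tight c c' :=
  forall u o X, head_in o -> tight c u o X = tight c' u o X.

Lemma same_tight_anchored c c' u o :
  same_tight c c' -> head_in o -> anchored c u o = anchored c' u o.
Proof.
move=> cc' oC; apply/idP/idP; rewrite -tight_least.
  by rewrite cc' //; apply: tight_sub_anchored.
by rewrite -cc' //; apply: tight_sub_anchored.
Qed.

Lemma same_tight_sign c c' u o s : same_tight c c' -> head_in o ->
  anchored c u o -> s \in S -> nonadj o s -> c.2 s = c'.2 s.
Proof.
move=> cc' oC cu sS os.
have cu' : anchored c' u o by rewrite -(same_tight_anchored _ cc').
have key X : tight c u o X ->
    agree (c.2 s) u (s \in X) /\ agree (c'.2 s) u (s \in X).
  move=> t; have := t; rewrite cc' //.
  by move: t => /andP[_ /forall_inP/(_ s sS)/implyP/(_ os)->]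
    /andP[_ /forall_inP/(_ s sS)/implyP/(_ os)->].
have := cu; rewrite -tight_least => /key.
have := cu; rewrite -tight_most => /key.
have := cu'; rewrite -tight_least -cc' // => /key.
have := cu'; rewrite -tight_most -cc' // => /key.
rewrite !inE.
by case: (c.2 s) => [[]|]; case: (c'.2 s) => [[]|]; case: u {cu cu' key} => /=
  -[? ?] [? ?] [? ?] [? ?].
Qed.

(** The vertices of a face tell which heads occur, hence the booleans and, except
    for blank nodes, the signs on the clique. The signs on the stable part are
    seen by any head to which the node is available: by the absence of a head
    if one of the booleans holds, and else by the heads that codomination
    supplies. *)
Lemma same_tight_inj c c' : good c -> good c' -> same_tight c c' -> c = c'.
Proof.
move=> gc gc' cc'.
have cc'' : same_tight c' c by move=> *; rewrite cc'.
have anE u o := @same_tight_anchored c c' u o cc'.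
have aE : c.1 = c'.1.
  have := (anE true None isT, anE false None isT); rewrite /= /base.
  by move: c.1 c'.1 => [? ?] [? ?] /= [-> ->].
case: c c' => [[a1 a2] e] [[a1' a2'] e'] /= in gc gc' cc' cc'' anE aE *.
case: aE => E1 E2; subst a1' a2'; congr (_, _).
have sE s u : base (a1, a2) u -> s \in S -> e s = e' s.
  by move=> au sS; apply: (same_tight_sign (o := None) (u := u) cc').
have signE k : (forall u, (e k == Some u) = (e' k == Some u)) -> e k = e' k.
  move=> H; have := (H true, H false).
  by case: (e k) (e' k) => [[]|] [[]|] //= [].
have kE : ~~ (a1 && a2) -> forall k, k \in C -> e k = e' k.
  move=> naa k kC; apply: signE => u.
  have := anE u (Some k) kC; rewrite /anchored /=.
  by rewrite !andbA (negbTE naa) /= !orbF.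
apply/ffunP => x; move: gc gc'; rewrite /good /=.
case: ifPn => [/andP[a1T a2T] dom dom'|naa].
  have {}sE s : s \in S -> e s = e' s by apply: (sE s true).
  have [xC|] := boolP (x \in C); last by rewrite -in_stable_part => /sE.
  have := anE ^~ (Some x) ^~ xC; rewrite /= a1T a2T /=.
  have -> : blank e' x = blank e x.
    by apply: eq_forallb => s; case: (boolP (s \in S)) => //= /sE ->.
  case: (boolP (blank e x)) => [bl _|_ H]; last first.
    by apply: signE => u; have := H u; rewrite !orbF.
  have blankN (f : signing) : dominated f -> blank f x -> f x = None.
    move=> /forall_inP/(_ x xC)/implyP dx /forall_inP bx.
    apply/eqP; apply: contraT => /dx /exists_inP[s sS /andP[xs]].
    by have := bx s sS; rewrite xs /= => ->.
  rewrite !blankN //.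
  by apply/forall_inP => s sS; rewrite -sE //; apply: (forall_inP bl).
have [xC _ _|] := boolP (x \in C); first exact: kE.
rewrite -in_stable_part => xS.
case: ifPn => [/orP[a1T|a2T] _ _|nor]; first exact: (sE x true).
  exact: (sE x false).
move=> /andP[_ /forall_inP/(_ x xS)/implyP gx].
move=> /andP[_ /forall_inP/(_ x xS)/implyP gx'].
have rec k : k \in C -> ~~ edge k x -> e k != None -> e x = e' x.
  move=> kC nkx; case ek: (e k) => [u|] // _.
  by apply: (same_tight_sign (o := Some k) (u := u) cc') => //=; rewrite ek eqxx.
case: (boolP (e x == None)) => [/eqP ex|/gx /exists_inP[k kC /andP[nkx ek]]].
  case: (boolP (e' x == None)) => [/eqP-> //|/gx' /exists_inP[k kC /andP[nkx]]].
  by rewrite -kE // => ek; apply: (rec k).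
exact: (rec k).
Qed.

(** A clique node refuting domination and a stable node refuting codomination
    could be neither adjacent nor nonadjacent. *)
Lemma dominated_or_codominated e : dominated e || codominated e.
Proof.
apply/norP => -[/forall_inPn[k kC]]; rewrite negb_imply => /andP[ek nk].
rewrite /codominated negb_and.
have -> /= : [exists k0 in C, e k0 != None] by apply/exists_inP; exists k.
move=> /forall_inPn[s sS]; rewrite negb_imply => /andP[es ns].
have [ks|nks] := boolP (edge k s).
  by case/exists_inP: nk; exists s; rewrite ?ks.
by case/exists_inP: ns; exists k; rewrite ?nks.
Qed.

Definition excess := #|[set e : signing | dominated e && codominated e]|.

Lemma card_good :
  #|[set c : code | good c]| = 3 ^ #|G|.+1 + excess.
Proof.
have cardT : #|[set: signing]| = 3 ^ #|G|.
  by rewrite cardsT card_ffun card_option card_bool.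
have -> : #|[set c : code | good c]| =
    \sum_(a : bool * bool) #|[set e : signing | good (a, e)]|.
  rewrite -sum1_card (eq_bigl (fun c : code => predT c.1 && good (c.1, c.2))).
    rewrite -(pair_big_dep predT (fun a e => good (a, e)) (fun _ _ => 1)) /=.
    by apply: eq_bigr => a _; rewrite -sum1_card; apply: eq_bigl => e; rewrite inE.
  by case=> a e; rewrite inE.
rewrite -(pair_bigA _ (fun b1 b2 => #|[set e : signing | good (b1, b2, e)]|)) /=.
rewrite !big_bool /= /good /=.
have -> : [set e : signing | true] = [set: signing] by apply/setP => e; rewrite !inE.
rewrite cardT.
have -> : excess = #|[set e | dominated e] :&: [set e | codominated e]|.
  by congr #|pred_of_set _|; apply/setP => e; rewrite !inE.
rewrite [X in X + _]addnC addnACA -cardsUI expnS mulSn mul2n -addnn.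
rewrite addnA addnC [RHS]addnC [3 ^ _ + (_ + _)]addnC; congr (_ + (_ + _)).
rewrite -cardT; congr #|pred_of_set _|; apply/setP => e; rewrite !inE.
exact: dominated_or_codominated.
Qed.

End SplitGraph.

(** * Vertices attaining the maximum of a functional *)

Section Slack.
Variables (R : realFieldType) (G : split_graph).
Notation C := (clique_part G).
Notation S := (stable_part G).
Local Open Scope ring_scope.

Definition sign_of (x : R) : option bool :=
  if x == 0 then None else Some (x < 0).

Definition side (u : bool) (x : R) := (-1) ^+ nat_of_bool u * x.

Lemma side_false x : side false x = x. Proof. exact: mul1r. Qed.
Lemma side_true x : side true x = - x. Proof. exact: mulN1r. Qed.
Definition sideE := (side_false, side_true).

Lemma agree_sign (x : R) u b :
  agree (sign_of x) u b = (side u x == 0) || (b == (0 < side u x)).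
Proof.
rewrite /sign_of; case: u; rewrite sideE ?oppr_eq0 ?oppr_gt0 /=;
  by case: (ltrgt0P x).
Qed.

(** What is lost by including or omitting a node of coefficient [x], compared
    with the better of the two choices. *)
Lemma agree_excess (x : R) u (b : bool) :
  0 <= Num.max (side u x) 0 - b%:R * side u x /\
  (Num.max (side u x) 0 - b%:R * side u x == 0) = agree (sign_of x) u b.
Proof.
rewrite agree_sign; case: (ltrgt0P (side u x)) => [y0|y0|->].
- by case: b; rewrite ?mul1r ?mul0r ?subrr ?subr0 ?eqxx ?lexx ?ltW // gt_eqF.
- case: b; rewrite ?mul1r ?mul0r ?subrr ?sub0r ?oppr0 ?eqxx ?lexx //=.
  by rewrite oppr_ge0 oppr_eq0 ltW // lt_eqF.
- by rewrite mulr0 subrr lexx eqxx.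
Qed.

(** The functional has value [c0] on the height coordinate and [w i] on the
    coordinate of the node [i]; [M] is a candidate for its maximum. *)
Section Functional.
Variables (c0 M : R) (w : G -> R).

Definition slack u (I : {set G}) := M - side u (c0 + \sum_(i in I) w i).

Definition ppart u s := Num.max (side u (w s)) 0.

(** The least slack over the stable sets with head [o] ([gap_slack]). *)
Definition gap u (o : option G) :=
  M - side u (c0 + (if o is Some k then w k else 0))
    - \sum_(s in S | nonadj o s) ppart u s.

Lemma sum_stable_of o X : head_in o ->
  \sum_(i in stable_of o X) w i =
  (if o is Some k then w k else 0) +
  \sum_(s in S | nonadj o s) (s \in X)%:R * w s.
Proof.
move=> oC; rewrite (bigID (mem C)) /=; congr (_ + _).
  case: o oC => [k|] /= kC; last first.
    by apply: big_pred0 => i; rewrite inE; case: (i \in C); rewrite ?andbF.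
  apply: big_pred1 => i; rewrite inE /=.
  case: ifP => [|iC]; rewrite ?andbT ?andbF; first by rewrite -[RHS]eq_sym.
  by apply/esym/eqP => ik; rewrite ik kC in iC.
rewrite [RHS](bigID (mem X)) /= [X in _ = _ + X]big1 ?addr0; last first.
  by move=> s /andP[_ /negbTE->]; rewrite mul0r.
apply: eq_big => [i|i /andP[+ iC]]; last first.
  by rewrite inE (negbTE iC) => /andP[_ ->]; rewrite mul1r.
rewrite inE in_stable_part; case: (i \in C) => /=; rewrite ?andbT ?andbF //.
Qed.

Lemma slackE u o X : head_in o ->
  slack u (stable_of o X) =
  gap u o + \sum_(s in S | nonadj o s) (ppart u s - (s \in X)%:R * side u (w s)).
Proof.
move=> oC; rewrite /slack sum_stable_of // /gap sumrB.
have -> : \sum_(s in S | nonadj o s) (s \in X)%:R * side u (w s) =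
          side u (\sum_(s in S | nonadj o s) (s \in X)%:R * w s).
  by rewrite /side mulr_sumr; apply: eq_bigr => s _; rewrite mulrCA.
by rewrite /side !mulrDr; ring.
Qed.

Lemma gap_slack u o : head_in o ->
  gap u o = slack u (stable_of o [set s | sign_of (w s) == Some u]).
Proof.
move=> oC; rewrite slackE // big1 ?addr0 // => s _.
have [_ h] := agree_excess (w s) u (s \in [set s | sign_of (w s) == Some u]).
apply/eqP; rewrite h inE.
by case: (sign_of (w s)) => [d|] //=; rewrite eqxx.
Qed.

Definition valid := forall u o, head_in o -> 0 <= gap u o.

Lemma slack_ge0 u o X : valid -> head_in o -> 0 <= slack u (stable_of o X).
Proof.
move=> v oC; rewrite slackE //; apply: addr_ge0; first exact: v.
apply: sumr_ge0 => s _; exact: (agree_excess _ _ _).1.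
Qed.

(** The slack is the gap plus nonnegative losses, one for each node of the stable
    part that is available to the head. *)
Lemma slack_eq0 u o X : valid -> head_in o ->
  (slack u (stable_of o X) == 0) =
  (gap u o == 0) &&
  [forall s in S, nonadj o s ==> agree (sign_of (w s)) u (s \in X)].
Proof.
move=> v oC; rewrite slackE // paddr_eq0 ?v //; last first.
  apply: sumr_ge0 => s _; exact: (agree_excess _ _ _).1.
congr andb; rewrite psumr_eq0; last by move=> s _; exact: (agree_excess _ _ _).1.
apply/allP/forall_inP => [h s sS|h s _].
  by have := h s (mem_index_enum _); rewrite sS /= (agree_excess _ _ _).2.
apply/implyP => /andP[sS os].
by rewrite (agree_excess _ _ _).2; apply: (implyP (h s sS)).
Qed.

Lemma gap_Some u k :
  gap u (Some k) =
  gap u None + \sum_(s in S | edge k s) ppart u s - side u (w k).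
Proof.
rewrite /gap /= [X in _ = M - _ - X + _ - _](bigID (edge k)) /=.
under [X in _ = M - _ - (X + _) + _ - _]eq_bigl do rewrite andbT.
under [X in _ = M - _ - (_ + X) + _ - _]eq_bigl do rewrite andbT.
rewrite /side !mulrDr; ring.
Qed.

(** The coefficient of [k] cancels between the two sides; this is what couples
    them. *)
Lemma gap_sum k :
  gap false (Some k) + gap true (Some k) =
  gap false None + gap true None +
  \sum_(s in S | edge k s) (ppart false s + ppart true s).
Proof. by rewrite !gap_Some big_split /= /side /= expr0 expr1; ring. Qed.

Lemma ppart_ge0 u s : 0 <= ppart u s.
Proof. by rewrite le_max lexx orbT. Qed.

Lemma ppart_sum_eq0 s :
  (ppart false s + ppart true s == 0) = (sign_of (w s) == None).
Proof.
rewrite /sign_of /ppart !sideE; case: (ltrgt0P (w s)) => [h|h|->] /=.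
- by rewrite max_r ?oppr_le0 ?ltW // addr0 gt_eqF.
- by rewrite max_l ?oppr_ge0 ?ltW // add0r oppr_eq0 lt_eqF.
- by rewrite oppr0 ?maxxx addr0 !eqxx.
Qed.

Lemma both_gaps_eq0 k : valid -> k \in C ->
  (gap true (Some k) == 0) && (gap false (Some k) == 0) =
  [&& gap true None == 0, gap false None == 0 &
      [forall s in S, edge k s ==> (sign_of (w s) == None)]].
Proof.
move=> v kC; rewrite andbC -paddr_eq0 ?v // gap_sum paddr_eq0; first last.
- by apply: sumr_ge0 => s _; rewrite addr_ge0 ?ppart_ge0.
- by rewrite addr_ge0 ?v.
rewrite paddr_eq0 ?v // [X in X && _]andbC -andbA; congr [&& _, _ & _].
rewrite psumr_eq0; last by move=> s _; rewrite addr_ge0 ?ppart_ge0.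
apply/allP/forall_inP => [h s sS|h s _].
  by have := h s (mem_index_enum _); rewrite sS /= ppart_sum_eq0.
by apply/implyP => /andP[sS ks]; rewrite ppart_sum_eq0; apply: (implyP (h s sS)).
Qed.

Definition raw_sign k :=
  if k \in C then
    if gap true (Some k) == 0 then
      if gap false (Some k) == 0 then None else Some true
    else if gap false (Some k) == 0 then Some false else None
  else sign_of (w k).

(** Read off the functional, but not yet canonical: with no tight vertex avoiding
    the clique, the sign of a node adjacent to all heads is arbitrary. *)
Definition raw_code : code G :=
  (gap true None == 0, gap false None == 0, [ffun k => raw_sign k]).

Lemma raw_signS s : s \in S -> raw_sign s = sign_of (w s).
Proof. by rewrite in_stable_part /raw_sign => /negbTE->. Qed.

Lemma raw_anchored u o : valid -> head_in o ->
  anchored raw_code u o = (gap u o == 0).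
Proof.
move=> v; case: o => [k|] /=; last by case: u.
move=> kC; have := both_gaps_eq0 v kC.
have -> : blank [ffun k => raw_sign k] k =
    [forall s in S, edge k s ==> (sign_of (w s) == None)].
  apply: eq_forallb => s; case: (boolP (s \in S)) => //= sS.
  by rewrite ffunE raw_signS.
rewrite !ffunE /raw_sign kC => <-.
by case: u; case: (gap true _ == 0); case: (gap false _ == 0).
Qed.

Lemma raw_tight u o X : valid -> head_in o ->
  tight raw_code u o X = (slack u (stable_of o X) == 0).
Proof.
move=> v oC; rewrite slack_eq0 // /tight raw_anchored //; congr andb.
apply: eq_forallb => s; case: (boolP (s \in S)) => //= sS.
by rewrite ffunE raw_signS.
Qed.

(** If both gaps without a head are positive, no vertex of the face sees the sign
    of a stable node adjacent to every nonzero clique node, so this sign can be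
    reset to 0; the result is codominated. In the other cases [raw_code] is
    good. *)
Lemma good_code_of_functional : valid ->
  (exists u o, head_in o /\ gap u o = 0) ->
  exists2 c : code G, good c &
  forall u o X, head_in o ->
     tight c u o X = (slack u (stable_of o X) == 0).
Proof.
move=> v [u0 [o0 [o0C g0]]].
pose e := raw_code.2.
(* A clique node is nonzero when it is a head on exactly one side. *)
have eC k : k \in C -> (e k != None) =
    (gap true (Some k) == 0) (+) (gap false (Some k) == 0).
  move=> kC; rewrite /e ffunE /raw_sign kC.
  by case: (gap true _ == 0); case: (gap false _ == 0).
have [/norP[nt nf]|nor] :=
  boolP (~~ ((gap true None == 0) || (gap false None == 0))); last first.
  exists raw_code; last by move=> *; apply: raw_tight.
  rewrite /good /=; case: ifP => [/andP[gt gf]|_]; last by rewrite (negbNE nor).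
  apply/forall_inP => k kC; apply/implyP; rewrite -/e eC // => ek.
  have := both_gaps_eq0 v kC; rewrite gt gf /=.
  have -> : (gap true (Some k) == 0) && (gap false (Some k) == 0) = false.
    by move: ek; case: (gap true _ == 0); case: (gap false _ == 0).
  move/esym/negbT/forall_inPn => [s sS]; rewrite negb_imply => /andP[ks ws].
  by apply/exists_inP; exists s => //; rewrite ks ffunE raw_signS.
have eC' k u : k \in C -> gap u (Some k) = 0 -> e k = Some u.
  move=> kC gk; have := both_gaps_eq0 v kC; rewrite (negbTE nt) /=.
  by rewrite /e ffunE /raw_sign kC; case: u gk => ->; rewrite eqxx ?andbT /= => ->.
(* From here on no tight vertex avoids the clique. *)
pose e' : signing G := [ffun x => if (x \in S) &&
   [forall k in C, (e k != None) ==> edge k x] then None else e x].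
have e'C k : k \in C -> e' k = e k.
  by move=> kC; rewrite ffunE in_stable_part kC.
exists (gap true None == 0, gap false None == 0, e').
  rewrite /good /= (negbTE nt) (negbTE nf) /= /codominated.
  apply/andP; split.
    case: o0 => [k|] in o0C g0.
      by apply/exists_inP; exists k; rewrite // e'C // (eC' _ u0).
    by case: u0 g0 => g0; move: nt nf; rewrite g0 eqxx.
  apply/forall_inP => s sS; apply/implyP; rewrite ffunE sS /=.
  case: ifPn => // /forall_inPn[k kC]; rewrite negb_imply => /andP[ek nks] _.
  by apply/exists_inP; exists k; rewrite // nks e'C.
move=> u o X oC; rewrite -raw_tight // /tight.
have -> : anchored (gap true None == 0, gap false None == 0, e') u o =
          anchored raw_code u o.
  by case: o oC => [k kC|] //=; rewrite (negbTE nt) /= e'C.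
apply: andb_id2l; rewrite raw_anchored // => /eqP go.
case: o oC go => [k kC gk|_ g0']; last first.
  by case: u g0' => g0'; move: nt nf; rewrite g0' eqxx.
apply: eq_forallb => s; case: (boolP (s \in S)) => //= sS.
case: (boolP (edge k s)) => //= nks.
have -> : e' s = if [forall k in C, (e k != None) ==> edge k s] then None else e s.
  by rewrite ffunE sS.
case: ifP => // /forall_inP/(_ k kC)/implyP.
by rewrite (eC' k u) // => /(_ isT); rewrite (negbTE nks).
Qed.

End Functional.

(** Every code, good or not, is realized by an explicit functional. On the stable
    part the coefficients are 1, -1 or 0. The height coordinate and the maximum
    are chosen such that the gap without a head is 0 or 1 on each side, as the
    booleans demand. A clique node may then have any coefficient between
    - cap true and cap false; its upper and lower gap vanish at the right and
    left end of this interval, so the sign selects an end or the midpoint. *)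
Section Realize.
Variables (c : code G).
Let e := c.2.

Let cap (u : bool) k : R :=
  (~~ base c.1 u)%:R + \sum_(s in S | edge k s) (e s == Some u)%:R.

Let w (x : G) : R :=
  if x \in C then
    if e x is Some d then side d (cap d x) else (cap false x - cap true x) / 2
  else if e x is Some d then side d 1 else 0.

Let total (u : bool) : R := (~~ base c.1 u)%:R + \sum_(s in S) (e s == Some u)%:R.
Let M : R := (total true + total false) / 2.
Let c0 : R := (total true - total false) / 2.

Let wS s : s \in S -> w s = if e s is Some d then side d 1 else 0.
Proof. by rewrite in_stable_part /w => /negbTE->. Qed.

Let sign_w s : s \in S -> sign_of (w s) = e s.
Proof.
move=> sS; rewrite wS // /sign_of /side; case: (e s) => [[]|]; rewrite ?eqxx //.
  by rewrite expr1 mulr1 ltrN10 oppr_eq0 oner_eq0.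
by rewrite expr0 mulr1 ltr10 oner_eq0.
Qed.

Let ppart_w u s : s \in S -> ppart w u s = (e s == Some u)%:R.
Proof.
move=> sS; rewrite /ppart wS //; case: (e s) => [d|]; last first.
  by rewrite /side mulr0 maxxx.
by case: d u => [] []; rewrite !sideE ?opprK /= ?(max_l ler01) ?(max_r (lerN10 R)).
Qed.

Let gapN u : gap c0 M w u None = (~~ base c.1 u)%:R.
Proof.
rewrite /gap /= (eq_bigr (fun s => (e s == Some u)%:R)); last first.
  by move=> s /andP[sS _]; rewrite ppart_w.
under eq_bigl do rewrite andbT.
by rewrite /c0 /M /total addr0; case: u; rewrite sideE; field.
Qed.

Let gapS u k : gap c0 M w u (Some k) = cap u k - side u (w k).
Proof.
rewrite gap_Some gapN /cap; congr (_ + _ - _).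
by apply: eq_bigr => s /andP[sS _]; rewrite ppart_w.
Qed.

Let cap_ge0 u k : 0 <= cap u k.
Proof. by rewrite addr_ge0 ?ler0n ?sumr_ge0 // => *; rewrite ler0n. Qed.

Let gapSE u k : k \in C -> gap c0 M w u (Some k) =
  if e k is Some d then if d == u then 0 else cap true k + cap false k
  else (cap true k + cap false k) / 2.
Proof.
move=> kC; rewrite gapS /w kC; case: (e k) => [d|].
  by case: d u => [] []; rewrite !sideE; ring.
by case: u; rewrite !sideE; field.
Qed.

Let cap_sum_eq0 k :
  (cap true k + cap false k == 0) = [&& c.1.1, c.1.2 & blank e k].
Proof.
rewrite paddr_eq0 ?cap_ge0 // /cap !paddr_eq0 ?ler0n ?sumr_ge0 //;
  try by move=> *; rewrite ler0n.
rewrite !pnatr_eq0 !eqb0 !negbK /=.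
rewrite andbACA [RHS]andbA; congr (_ && _).
rewrite /blank !psumr_eq0; try by move=> *; rewrite ler0n.
apply/andP/forall_inP => [[/allP ht /allP hf] s sS|h].
  have := hf s (mem_index_enum _); have := ht s (mem_index_enum _).
  by rewrite sS /= !pnatr_eq0 !eqb0; case: (edge k s) => //=; case: (e s) => [[]|].
split; apply/allP => s _; apply/implyP => /andP[sS ks];
  by have := h s sS; rewrite ks /= => /eqP->.
Qed.

Lemma realize_code : exists c0 M (w : G -> R),
  valid c0 M w /\ forall u o X, head_in o ->
    (slack c0 M w u (stable_of o X) == 0) = tight c u o X.
Proof.
have v : valid c0 M w.
  move=> u [k kC|_]; last by rewrite gapN ler0n.
  rewrite gapSE //; have := addr_ge0 (cap_ge0 true k) (cap_ge0 false k).
  by case: (e k) => [d|]; [case: ifP|]; rewrite ?lexx //; lra.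
exists c0, M, w; split=> // u o X oC; rewrite slack_eq0 //; congr andb.
  case: o oC => [k kC|_] /=; last by rewrite gapN pnatr_eq0 eqb0 negbK.
  rewrite gapSE // -/e -cap_sum_eq0; case ek: (e k) => [d|] /=.
    case: (eqVneq d u) => [->|du]; first by rewrite !eqxx.
    by rewrite -(inj_eq Some_inj) in du; rewrite (negbTE du).
  by rewrite mulf_eq0 invr_eq0 pnatr_eq0 orbF.
by apply: eq_forallb => s; case: (boolP (s \in S)) => //= sS; rewrite sign_w.
Qed.

End Realize.
End Slack.

(** * Convex hulls and the faces of Hansen polytopes *)

Section Convexity.
Variables (R : realType) (E : lmodType R).
Local Open Scope ring_scope.
Local Open Scope classical_set_scope.
Local Open Scope convex_scope.

Lemma conv_hull_min (A B : set E) :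
  @convex_set R E B -> A `<=` B -> conv_hull A `<=` B.
Proof. by move=> cB AB; apply: smallest_sub. Qed.

Lemma sub_conv_hull (A : set E) : A `<=` conv_hull A.
Proof. exact: sub_gen_smallest. Qed.

Lemma convex_setP (B : set E) :
  (forall (x y : E) (t : R), 0 < t -> t < 1 -> B x -> B y ->
     B (t *: x + (1 - t) *: y)) -> @convex_set R E B.
Proof.
move=> h; apply/convex_setW => x y; rewrite !inE => Bx By k k0 k1.
rewrite inE; exact: h.
Qed.

Lemma convex_lt (f : {scalar E}) d : @convex_set R E [set x | f x < d].
Proof.
apply: convex_setP => x y t t0 t1 /= fx fy; rewrite linearD !linearZ /=.
have -> : d = t * d + (1 - t) * d by ring.
by rewrite ltrD // ltr_pM2l // subr_gt0.
Qed.

Lemma convex_le (f : {scalar E}) d : @convex_set R E [set x | f x <= d].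
Proof.
apply: convex_setP => x y t t0 t1 /= fx fy; rewrite linearD !linearZ /=.
have -> : d = t * d + (1 - t) * d by ring.
by rewrite lerD // ler_pM2l // subr_gt0.
Qed.

(** This set expresses that the face of [f] is contained in that of [g]; as it is
    convex, the containment need only be tested on vertices. *)
Lemma convex_tight (f g : {scalar E}) d d' :
  @convex_set R E [set x | f x <= d /\ (f x = d -> g x = d')].
Proof.
apply: convex_setP => x y t t0 t1 /= [fx gx] [fy gy].
rewrite !linearD !linearZ /=.
have t1' : 0 < 1 - t by rewrite subr_gt0.
have dE : d = t * d + (1 - t) * d by ring.
have lx : t * f x <= t * d by rewrite ler_pM2l.
have ly : (1 - t) * f y <= (1 - t) * d by rewrite ler_pM2l.
split; first by rewrite [leRHS]dE lerD.
move=> fd.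
have xd : t * f x = t * d by lra.
have yd : (1 - t) * f y = (1 - t) * d by lra.
have {}xd : f x = d by apply: (mulfI (lt0r_neq0 t0)).
have {}yd : f y = d by apply: (mulfI (lt0r_neq0 t1')).
by rewrite gx // gy //; ring.
Qed.

End Convexity.

Lemma card_finset (T : finType) (A : {set T}) : ([set` A] #= `I_#|A|)%card.
Proof.
have -> : [set` A]%classic = (@enum_val T (mem A) @` setT)%classic.
  apply/seteqP; split=> [x xA|_ [i _ <-]] /=; last exact: enum_valP.
  by exists (enum_rank_in xA x); rewrite ?enum_rankK_in.
apply: card_eq_trans (inj_card_eq _) _; first by move=> i j _ _; apply: enum_val_inj.
by rewrite card_eq_sym card_II.
Qed.

Section Hansen.
Variables (R : realType).
Local Open Scope ring_scope.
Local Open Scope classical_set_scope.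
Local Open Scope convex_scope.

Section Graph.
Variable G : sgraph.
Notation E := (R^o * {ffun G -> R^o})%type.

Definition vertex (u : bool) (I : {set G}) : E :=
  (-1) ^+ u *: ((1, @incidence R G I) : E).

Lemma vertex_hansen u I : stable I -> hansen R G (vertex u I).
Proof.
move=> stI; apply: sub_conv_hull.
have Q : ([set 1] `*` stab R G) ((1, @incidence R G I) : E).
  by split=> //; apply: sub_conv_hull; exists I.
case: u; rewrite /vertex /= ?expr0 ?expr1 ?scale1r ?scaleN1r; last by left.
by right; exists (1, @incidence R G I).
Qed.

(** The two nested convex hulls act as a single hull of the vertices. *)
Lemma hansen_min (B : set E) : @convex_set R E B ->
  (forall u I, stable I -> B (vertex u I)) -> hansen R G `<=` B.
Proof.
move=> cB vB; apply: conv_hull_min => //.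
have key u x : stab R G x -> B ((-1) ^+ nat_of_bool u *: ((1, x) : E)).
  move: x.
  apply: (conv_hull_min
    (B := [set x | B ((-1) ^+ nat_of_bool u *: ((1, x) : E))])).
    apply/convex_setW => x y; rewrite !inE /= => Bx By k k0 k1; rewrite inE /=.
    have /set_mem := cB _ _ k (mem_set Bx) (mem_set By); congr B.
    rewrite -[LHS]/(k%:num *: _ + (1 - k%:num) *: _) !scalerA.
    rewrite ![_ * (-1) ^+ _]mulrC -!scalerA -scalerDr; congr (_ *: _).
    congr (_, _) => /=.
    by rewrite -[LHS]/(k%:num * 1 + (1 - k%:num) * 1); ring.
  by move=> _ [I stI <-]; apply: vB.
move=> x [[x1 xs]|[y [y1 ys] <-]].
  by have := key false _ xs; rewrite expr0 scale1r -[1](x1) -surjective_pairing.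
by have := key true _ ys; rewrite expr1 scaleN1r -[1](y1) -surjective_pairing.
Qed.

Definition functional (c0 : R) (w : G -> R) (x : E) : R :=
  c0 * x.1 + \sum_i w i * x.2 i.

Lemma functional_is_linear c0 w :
  linear_for *%R (functional c0 w).
Proof.
move=> a x y; rewrite /functional /= mulrDr mulrDr addrACA mulr_sumr -big_split /=.
congr (_ + _); first by rewrite -[_ *: _]/(_ * _) mulrCA.
by apply: eq_bigr => i _; rewrite !ffunE -[_ *: _]/(_ * _); ring.
Qed.

HB.instance Definition _ c0 w :=
  GRing.isLinear.Build R E R _ (functional c0 w) (functional_is_linear c0 w).

Lemma functional_vertex c0 (w : G -> R) u I :
  functional c0 w (vertex u I) = side u (c0 + \sum_(i in I) w i).
Proof.
rewrite /vertex linearZ /= /functional /side /= mulr1; congr (_ * (_ + _)).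
rewrite [RHS]big_mkcond; apply: eq_bigr => i _ /=.
by rewrite ffunE; case: (i \in I); rewrite /= ?mulr1 ?mulr0.
Qed.

Lemma scalar_vertex (f : {scalar E}) : exists c0 (w : G -> R),
  forall u I, f (vertex u I) = side u (c0 + \sum_(i in I) w i).
Proof.
pose delta i : {ffun G -> R^o} := [ffun j => (j == i)%:R].
exists (f (1, 0)), (fun i => f (0, delta i)) => u I.
rewrite /vertex linearZ /side /=; congr (_ * _).
rewrite -linear_sum -linearD /=; congr (f _).
have -> : \sum_(i in I) ((0, delta i) : E) = (0, \sum_(i in I) delta i).
  apply: (big_ind2 (fun x y => x = (0, y) :> E)) => // x y z t -> ->.
  by rewrite -[LHS]/((0 + 0, y + t) : E) addr0.
congr (_, _) => /=; first by rewrite addr0.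
rewrite add0r; apply/ffunP => j; rewrite sum_ffunE ffunE.
under eq_bigr do rewrite ffunE.
case: (boolP (j \in I)) => jI.
  rewrite (bigD1 j) //= eqxx big1 ?addr0 // => i /andP[_ /negbTE].
  by rewrite eq_sym => ->.
by rewrite big1 // => i iI; case: eqP => // ji; rewrite ji iI in jI.
Qed.

End Graph.

Variable G : split_graph.
Notation E := (R^o * {ffun G -> R^o})%type.

(** A face and a code agree if they have the same vertices. *)
Definition encodes (F : set E) (c : code G) := forall u o X, head_in o ->
  F (vertex u (stable_of o X)) <-> tight c u o X.

Lemma stable_vertex (P : bool -> {set G} -> Prop) :
  (forall u o X, head_in o -> P u (stable_of o X)) ->
  forall u I, stable I -> P u I.
Proof. by move=> h u I /stable_ofE[o oC ->]; apply: h. Qed.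

(** A face containing a point contains a vertex, since otherwise the whole
    polytope would lie in the convex set where the functional is below its
    maximum. *)
Lemma face_encoded (F : set E) : face (hansen R G) F -> F !=set0 ->
  exists2 c, good c & encodes F c.
Proof.
move=> [f [M [fM ->]]] [x [Hx fx]].
have [c0 [w fE]] := scalar_vertex f.
have slk u I : slack c0 M w u I = M - f (vertex u I) by rewrite fE.
have v : valid c0 M w.
  move=> u o oC; rewrite gap_slack // slk subr_ge0; apply: fM.
  exact: vertex_hansen (stable_ofP _).
have [u [I [stI fI]]] : exists u I, stable I /\ f (vertex u I) = M.
  apply: contrapT => no.
  suff /(_ _ Hx) /= : hansen R G `<=` [set x | f x < M].
    by move: fx => /= ->; rewrite ltxx.
  apply: hansen_min; first exact: convex_lt.
  move=> u I stI /=; rewrite lt_neqAle fM ?andbT; last exact: vertex_hansen.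
  by apply/eqP => fI; apply: no; exists u, I.
have [o oC IE] := stable_ofE stI.
have : slack c0 M w u (stable_of o I) == 0 by rewrite slk -IE fI subrr.
rewrite slack_eq0 // => /andP[/eqP g _].
have [|c gc cE] := good_code_of_functional v; first by exists u, o.
exists c => // u' o' X oC'.
rewrite cE // slk subr_eq0 eq_sym; split=> [[_ /eqP//]|/eqP e].
by split=> //; apply: vertex_hansen (stable_ofP _).
Qed.

Lemma code_face (c : code G) : good c ->
  exists F : set E, [/\ face (hansen R G) F, F !=set0 & encodes F c].
Proof.
move=> gc; have [c0 [M [w [v cE]]]] := realize_code R c.
pose f : {scalar E} := functional c0 w.
have slk u I : slack c0 M w u I = M - f (vertex u I).
  by rewrite /f /= functional_vertex.
exists (hansen R G `&` [set x | f x = M]).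
have en : encodes (hansen R G `&` [set x | f x = M]) c.
  move=> u o X oC.
  rewrite -cE // slk subr_eq0 eq_sym; split=> [[_ /eqP//]|/eqP e].
  by split=> //; apply: vertex_hansen (stable_ofP _).
split=> //.
  exists f, M; split=> //; apply: hansen_min; first exact: convex_le.
  apply: stable_vertex => u o X oC /=; rewrite -subr_ge0 -slk.
  exact: slack_ge0.
have [u [o [oC an]]] : exists u o, head_in o /\ anchored c u o.
  move: gc; rewrite /good; case: ifP => [/andP[a1 _] _|_].
    by exists true, None.
  case: ifP => [/orP[a1|a2] _|_]; [by exists true, None|by exists false, None|].
  move=> /andP[/exists_inP[k kC]]; case ek: (c.2 k) => [u|] // _ _.
  by exists u, (Some k); rewrite /= ek eqxx.
exists (vertex u (stable_of o [set s | c.2 s == Some u]%SET)).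
by apply/en; rewrite ?tight_least.
Qed.

Lemma sub_encoded (F F' : set E) c :
  face (hansen R G) F -> face (hansen R G) F' ->
  encodes F c -> encodes F' c -> F `<=` F'.
Proof.
move=> [f [M [fM FE]]] [g [N [gN FE']]] en en' x; rewrite FE FE' => -[Hx fx].
split=> //.
suff /(_ _ Hx) /= [_ ->] :
  hansen R G `<=` [set x | f x <= M /\ (f x = M -> g x = N)] by [].
apply: hansen_min; first exact: convex_tight.
apply: stable_vertex => u o X oC /=.
have vH := vertex_hansen u (stable_ofP (o:=o) (X:=X) oC).
split; first exact: fM.
move=> fv; have /en : F (vertex u (stable_of o X)) by rewrite FE.
by move=> /(_ oC)/en'-/(_ oC); rewrite FE' => -[].
Qed.

Lemma encodes_inj (F : set E) c c' :
  good c -> good c' -> encodes F c -> encodes F c' -> c = c'.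
Proof.
move=> gc gc' en en'; apply: same_tight_inj => // u o X oC.
by apply/idP/idP => [/en|/en']-/(_ oC); [move/en'|move/en]; apply.
Qed.

Local Open Scope card_scope.

(** Good codes and nonempty faces correspond bijectively: each face has a good
    code, each good code comes from a face, and both are determined by the
    vertices. *)
Theorem card_faces_hansen :
  nonempty_faces (hansen R G) #=
  `I_(3 ^ #|G|.+1 + excess G)%N.
Proof.
pose c_dflt : code G := (true, true, [ffun=> None]).
have /choice[phi phiP] F : exists c,
    nonempty_faces (hansen R G) F -> good c /\ encodes F c.
  have [[fF F0]|nF] := pselect (nonempty_faces (hansen R G) F).
    by have [c gc cE] := face_encoded fF F0; exists c.
  by exists c_dflt.
have inj : {in nonempty_faces (hansen R G) &, injective phi}.
  move=> F F' /set_mem nF /set_mem nF' e.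
  have [_ en] := phiP _ nF; have [_ en'] := phiP _ nF'; rewrite -e in en'.
  case: nF nF' => [fF _] [fF' _].
  by rewrite eqEsubset; split; apply: sub_encoded; eassumption.
apply: (card_eq_trans (B := phi @` nonempty_faces (hansen R G))).
  by rewrite card_eq_sym; apply: inj_card_eq.
have -> : phi @` nonempty_faces (hansen R G) = [set` [set c : code G | good c]%SET].
  apply/seteqP; split=> [_ [F nF <-]|c] /=; rewrite inE.
    by have [] := phiP _ nF.
  move=> gc; have [F [fF F0 en]] := code_face gc.
  have nF : nonempty_faces (hansen R G) F by [].
  exists F => //; have [gp enp] := phiP _ nF; exact: encodes_inj enp en.
rewrite -card_good; exact: card_finset.
Qed.

End Hansen.

(** * Extension by a threshold graph *)

(** A consequence of the neighbourhoods of the clique nodes forming a chain: any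
    node of [X] adjacent to the node of [Y] with the least neighbourhood is
    adjacent to all of [Y]. This form passes directly through the recursive
    construction of threshold graphs. *)
Definition nested (T : sgraph) (K : {set T}) :=
  forall X Y : pred T, {in X, forall x, x \notin K} -> {in Y, forall y, y \in K} ->
    (exists y, y \in Y) ->
    {in Y, forall y, exists2 x, x \in X & edge y x} ->
    exists2 x, x \in X & {in Y, forall y, edge y x}.

(** An isolated node joins the stable part and is never a neighbour of [Y]; a
    dominating node joins the clique and is adjacent to whatever is chosen for
    the rest of [Y]. *)
Lemma threshold_nested (T : sgraph) : threshold T ->
  exists K : {set T}, [/\ clique K, stable (~: K) & nested K].
Proof.
elim=> {T} [T T0|T _ [K [clK stK nestK]]|T _ [K [clK stK nestK]]
           |T U [f [g fK gK] fE] _ [K [clK stK nestK]]].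
- have noT (x : T) : False by have := fintype0 x T0.
  by exists finset.set0; split=> [x|x|X Y _ _ [y]]; case: (noT x) || case: (noT y).
- exists [set x : option T | if x is Some t then t \in K else false].
  split.
  + move=> [x|] [y|]; rewrite !inE //= => xK yK xy.
    by apply: clK => //; apply: contra xy => /eqP->.
  + move=> [x|] [y|]; rewrite !inE //= => xK yK.
    by apply: stK; rewrite inE.
  + move=> X Y XK YK [y0 Yy0] dom.
    have YS y : y \in Y -> exists2 t, y = Some t & t \in K.
      by move=> /YK; case: y => [t|]; rewrite inE //; exists t.
    have [x Xx xY] : exists2 x, x \in (fun t => Some t \in X) &
        {in (fun t => Some t \in Y), forall y, edge y x}.
      apply: nestK => [x /XK|y /YK||y /dom]; rewrite ?inE //.
        by have [t tE _] := YS _ Yy0; exists t; rewrite unfold_in -tE.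
      by case=> -[x|] //; exists x.
    exists (Some x) => // y Yy; have [t tE _] := YS _ Yy.
    by rewrite tE /=; apply: xY; rewrite unfold_in -tE.
- exists [set x : option T | if x is Some t then t \in K else true].
  split.
  + move=> [x|] [y|]; rewrite !inE //= => xK yK xy.
    by apply: clK => //; apply: contra xy => /eqP->.
  + move=> [x|] [y|]; rewrite !inE //= => xK yK.
    by apply: stK; rewrite inE.
  + move=> X Y XK YK [y0 Yy0] dom.
    have XS x : x \in X -> exists2 t, x = Some t & t \notin K.
      by move=> /XK; case: x => [t|]; rewrite inE //; exists t.
    case: (pickP (fun t => Some t \in Y)) => [t Yt|Y0]; last first.
      have [x Xx _] := dom _ Yy0; exists x => // -[y|] Yy.
        by have := Y0 y; rewrite /= Yy.
      by have [t -> _] := XS _ Xx.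
    have [x Xx xY] : exists2 x, x \in (fun t => Some t \in X) &
        {in (fun t => Some t \in Y), forall y, edge y x}.
      apply: nestK => [x /XK|y /YK||y /dom]; rewrite ?inE //.
        by exists t.
      case=> x Xx; have [x' xE _] := XS _ Xx.
      by rewrite xE in Xx * => ?; exists x'.
    by exists (Some x) => // -[y|] //; apply: xY.
- exists [set y | g y \in K].
  have gE x y : edge (g x) (g y) = edge x y by rewrite -fE !gK.
  split.
  + move=> x y; rewrite !inE -gE => xK yK xy; apply: clK => //.
    by apply: contra xy => /eqP/(can_inj gK)->.
  + by move=> x y; rewrite !inE -gE => xK yK; apply: stK; rewrite inE.
  + move=> X Y XK YK [y0 Yy0] dom.
    have [x Xx xY] : exists2 x, x \in (fun t => f t \in X) &
        {in (fun t => f t \in Y), forall y, edge y x}.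
      apply: nestK => [x /XK|y /YK||y /dom]; rewrite ?inE ?fK //.
        by exists (g y0); rewrite unfold_in gK.
      case=> x Xx yx; exists (g x); rewrite ?unfold_in ?gK //.
      by rewrite -gE fK in yx.
    exists (f x) => // y Yy; rewrite -gE fK; apply: xY.
    by rewrite unfold_in gK.
Qed.

Section LtimesSplit.
Variables (G : split_graph) (T : sgraph) (K : {set T}).
Hypotheses (clK : clique K) (stK : stable (~: K)).

Definition ltimes_clique : {set ltimes G T} :=
  [set x : G + T |
    match x with inl u => u \in clique_part G | inr t => t \in K end].

Lemma ltimes_cliqueP : clique ltimes_clique.
Proof.
move=> [x|x] [y|y]; rewrite !inE //= => xC yC xy.
  by apply: clique_partP => //; apply: contra xy => /eqP->.
by apply: clK => //; apply: contra xy => /eqP->.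
Qed.

Lemma ltimes_stableP : stable (~: ltimes_clique).
Proof.
move=> [x|x] [y|y]; rewrite !inE //= => xC yC.
  by apply: (stable_partP (s := G)); rewrite in_stable_part.
by apply: stK; rewrite inE.
Qed.

Lemma ltimes_disjoint : [disjoint ltimes_clique & ~: ltimes_clique].
Proof. by rewrite -finset.setI_eq0 finset.setICr. Qed.

Definition ltimes_split : split_graph :=
  SplitGraph ltimes_cliqueP ltimes_stableP (finset.setUCr _) ltimes_disjoint.

Definition extend (e : signing G) : signing ltimes_split :=
  [ffun x : G + T => if x is inl u then e u else None].

Lemma extend_inj : injective extend.
Proof.
move=> e e' /ffunP ee'; apply/ffunP => x.
by have := ee' (inl x); rewrite !ffunE.
Qed.

Lemma stable_ltimes_inl u :
  (inl u \in stable_part ltimes_split) = (u \in stable_part G).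
Proof. by rewrite !inE in_stable_part. Qed.

Lemma stable_ltimes_inr t : (inr t \in stable_part ltimes_split) = (t \notin K).
Proof. by rewrite !inE. Qed.

Lemma clique_ltimes_inl u :
  (inl u \in clique_part ltimes_split) = (u \in clique_part G).
Proof. by rewrite inE. Qed.

Lemma clique_ltimes_inr t : (inr t \in clique_part ltimes_split) = (t \in K).
Proof. by rewrite inE. Qed.

Definition memE :=
  (stable_ltimes_inl, stable_ltimes_inr, clique_ltimes_inl, clique_ltimes_inr).

Lemma dominated_extend e : dominated (extend e) = dominated e.
Proof.
apply/forall_inP/forall_inP => h.
  move=> k kC; apply/implyP => ek.
  have := h (inl k); rewrite memE ffunE ek => /(_ kC)/exists_inP[[s|t] sS].
    by rewrite ffunE => se; apply/exists_inP; exists s; rewrite // -memE.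
  by rewrite ffunE andbF.
move=> [k|t]; rewrite memE ffunE // => kC; apply/implyP => ek.
have := h k kC; rewrite ek => /exists_inP[s sS se]; apply/exists_inP.
by exists (inl s); rewrite ?memE // ffunE.
Qed.

Lemma codominated_extend e : codominated (extend e) = codominated e.
Proof.
apply/andP/andP => -[/exists_inP[k kC ek] /forall_inP h]; split.
- case: k kC ek => [k|t]; rewrite memE ffunE // => kC ek.
  by apply/exists_inP; exists k.
- apply/forall_inP => s sS; apply/implyP => es.
  have := h (inl s); rewrite memE ffunE es => /(_ sS)/exists_inP[[k'|t] kS].
    by rewrite ffunE => ke; apply/exists_inP; exists k'; rewrite // -memE.
  by rewrite ffunE andbF.
- by apply/exists_inP; exists (inl k); rewrite ?memE // ffunE.
- apply/forall_inP => -[s|t]; rewrite memE ffunE // => sS; apply/implyP => es.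
  have := h s sS; rewrite es => /exists_inP[k' kC' ke]; apply/exists_inP.
  by exists (inl k'); rewrite ?memE // ffunE.
Qed.

(** A nonzero clique node of [T] can only be dominated from within [T]. Then the
    nested property gives a nonzero node [x] of [T] adjacent to all nonzero clique
    nodes of [T]; as it is also adjacent to the whole clique of [G], codomination
    fails at [x]. With no nonzero clique node in [T], codomination forces the
    stable nodes of [T] to have sign 0 too. *)
Lemma zero_on_threshold (e : signing ltimes_split) : nested K ->
  dominated e -> codominated e -> forall t, e (inr t) = None.
Proof.
move=> nest /forall_inP dom /andP[_ /forall_inP codom].
have codomT t : t \notin K -> e (inr t) != None ->
    exists2 y, y \in K & ~~ edge y t && (e (inr y) != None).
  move=> tK et; have := codom (inr t); rewrite memE et => /(_ tK)/exists_inP[].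
  move=> [k|y]; rewrite memE /=; first by move=> ->.
  by move=> yK h; exists y.
have zK t : t \in K -> e (inr t) = None.
  move=> tK; apply/eqP; apply: contraT => et.
  have [||||x /andP[xK ex] xY] := nest
     (fun x => (x \notin K) && (e (inr x) != None))
     (fun y => (y \in K) && (e (inr y) != None)).
  - by move=> x /andP[].
  - by move=> x /andP[].
  - by exists t; rewrite unfold_in tK.
  - move=> y /andP[yK ey]; have := dom (inr y).
    rewrite memE ey => /(_ yK)/exists_inP[[u|x]]; rewrite memE /=.
      by rewrite in_stable_part => /negbTE->.
    by move=> xK /andP[yx ex]; exists x; rewrite // unfold_in xK.
  have [y yK /andP[/negP nyx ey]] := codomT x xK ex.
  by case: nyx; apply: xY; rewrite unfold_in yK.
move=> t; have [/zK //|tK] := boolP (t \in K).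
apply/eqP; apply: contraT => /(codomT t tK)[y yK /andP[_]].
by rewrite zK.
Qed.

Lemma card_excess_ltimes : nested K ->
  excess ltimes_split = excess G.
Proof.
move=> nest; rewrite /excess -(card_imset _ extend_inj); congr #|pred_of_set _|.
apply/setP => e; rewrite inE; apply/idP/imsetP => [/andP[de ce]|[f]]; last first.
  by rewrite inE => fd ->; rewrite dominated_extend codominated_extend.
have eE : e = extend [ffun x => e (inl x)].
  apply/ffunP => -[u|t]; rewrite !ffunE //.
  exact: (zero_on_threshold nest de ce).
exists [ffun x => e (inl x)]; last exact: eE.
by rewrite inE -dominated_extend -codominated_extend -eE de.
Qed.

End LtimesSplit.

(** The signings in question are those without a zero: each of the two conditions
    at one node of the path forces the next one of the cycle 1, 0, 2, 3 to be
    nonzero, and a nonzero middle node exists. *)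
Lemma card_excess_P4 : excess P4 = 16.
Proof.
rewrite /excess.
pose some (b : {ffun 'I_4 -> bool}) : signing P4 := [ffun i : 'I_4 => Some (b i)].
have some_inj : injective some.
  by move=> b b' /ffunP h; apply/ffunP => i; have := h i; rewrite !ffunE => -[].
have <- : #|some @: [set: {ffun 'I_4 -> bool}]| = 16.
  by rewrite card_imset // cardsT card_ffun card_bool card_ord.
congr #|pred_of_set _|; apply/setP => e; rewrite inE.
pose a n := e (inord n : 'I_4) != None.
have aE (i : 'I_4) : (e i != None) = a i by rewrite /a inord_val.
apply/andP/imsetP =>
  [[/forall_inP dom /andP[/exists_inP[k kC ek] /forall_inP codom]]|[b _ ->]].
  have a10 : a 1 -> a 0.
    move=> a1; have := dom (inord 1); rewrite inE /= inordK //= -/(a 1) a1.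
    move=> /(_ isT)/exists_inP[s]; rewrite inE aE /P4_edge /= inordK //=.
    by case: s => -[|[|[|[|]]]].
  have a23 : a 2 -> a 3.
    move=> a1; have := dom (inord 2); rewrite inE /= inordK //= -/(a 2) a1.
    move=> /(_ isT)/exists_inP[s]; rewrite inE aE /P4_edge /= inordK //=.
    by case: s => -[|[|[|[|]]]].
  have a02 : a 0 -> a 2.
    move=> a1; have := codom (inord 0); rewrite inE /= inordK //= -/(a 0) a1.
    move=> /(_ isT)/exists_inP[s]; rewrite inE aE /P4_edge /= inordK //=.
    by case: s => -[|[|[|[|]]]].
  have a31 : a 3 -> a 1.
    move=> a1; have := codom (inord 3); rewrite inE /= inordK //= -/(a 3) a1.
    move=> /(_ isT)/exists_inP[s]; rewrite inE aE /P4_edge /= inordK //=.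
    by case: s => -[|[|[|[|]]]].
  have a1 : a 1.
    move: ek kC; rewrite aE inE.
    by case: k => -[|[|[|[|k]]]] //= _ h _; auto.
  have all_a (i : 'I_4) : e i != None.
    by rewrite aE; case: i => -[|[|[|[|i]]]] //= _; auto.
  exists [ffun i => e i == Some true]; rewrite ?inE //.
  by apply/ffunP => i; rewrite !ffunE; have := all_a i; case: (e i) => [[]|].
split.
  apply/forall_inP => k kC; apply/implyP => _; apply/exists_inP.
  exists (if val k == 1 then inord 0 : 'I_4 else inord 3).
    by rewrite inE; case: ifP; rewrite inordK.
  move: kC; rewrite inE ffunE andbT /= /P4_edge.
  by case: k => -[|[|[|[|k]]]] //= _; rewrite inordK.
apply/andP; split.
  by apply/exists_inP; exists (inord 1 : 'I_4); rewrite ?inE ?ffunE ?inordK.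
apply/forall_inP => k kC; apply/implyP => _; apply/exists_inP.
exists (if val k == 0 then inord 2 : 'I_4 else inord 1).
  by rewrite inE; case: ifP; rewrite inordK.
move: kC; rewrite inE ffunE andbT /= /P4_edge.
by case: k => -[|[|[|[|k]]]] //= _; rewrite inordK.
Qed.

Local Open Scope card_scope.

Theorem corollary4p10 (R : realType) (m : nat) (T : sgraph)
    (T_threshold : threshold T) (T_card : #|T| = m) :
  nonempty_faces (hansen R (ltimes P4 T)) #= `I_(3 ^ (m + 5) + 16).
Proof.
have [K [clK stK nest]] := threshold_nested T_threshold.
have := card_faces_hansen R (ltimes_split P4 clK stK).
rewrite card_excess_ltimes // card_excess_P4.
have -> : #|ltimes_split P4 clK stK| = m + 4.
  by rewrite card_sum card_ord T_card addnC.
by rewrite -addnS.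
Qed.
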